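(* Let $\mathbb{F}$ be $\mathbb{R}$ or $\mathbb{C}$, let $U$ and $V$ be subsets of $\mathbb{F}^{d_1}$ and $\mathbb{F}^{d_2}$, respectively, and let $\mathbf{g}:U\to V$ and $\mathbf{f}:V\to\mathbb{F}^{d_3}$ be sufficiently differentiable functions. Then, for $\mathbf{n}\in\mathbb{N}^{d_1}$, the repeated application of the derivative yields $$\partial_{\mathbf{x}}^{\mathbf{n}}\,\mathbf{f}(\mathbf{g}(\mathbf{x}))=\sum_{|\mathbf{k}|=0}^{|\mathbf{n}|}\mathbf{f}^{(\mathbf{k})}(\mathbf{g}(\mathbf{x}))\;\mathcal{B}_{\mathbf{n},\mathbf{k}}\big(\mathbf{g}^{(\mathbf{j})}(\mathbf{x});\mathbf{j}\big),$$ where the sum is over all $\mathbf{k}\in\mathbb{N}^{d_2}$ with $0\le|\mathbf{k}|\le|\mathbf{n}|$, and $\mathcal{B}_{\mathbf{n},\mathbf{k}}(\mathbf{g}^{(\mathbf{j})}(\mathbf{x});\mathbf{j})$ is the partial multivariate Bell polynomial evaluated at the variables $\mathbf{x}_{\mathbf{j}}=\mathbf{g}^{(\mathbf{j})}(\mathbf{x})\in\mathbb{F}^{d_2}$.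
   Context: $\mathbb{N}$ denotes the nonnegative integers. For a multi-index $\mathbf{n}=(n_1,\dots,n_d)\in\mathbb{N}^d$: $|\mathbf{n}|=\sum_i n_i$, $\mathbf{n}!=\prod_i n_i!$, and for $\mathbf{x}\in\mathbb{F}^d$, $\mathbf{x}^{\mathbf{n}}=\prod_i x_i^{n_i}$. The multi-index derivative of a (scalar- or vector-valued) function is $\partial_{\mathbf{x}}^{\mathbf{n}}f(\mathbf{x})=f^{(\mathbf{n})}(\mathbf{x})=\partial_{x_1}^{n_1}\cdots\partial_{x_d}^{n_d}f(\mathbf{x})$, taken componentwise for vector-valued functions. Partial multivariate Bell polynomial: sums and products written $\sum_{|\mathbf{j}|=1}^\infty$, $\prod_{|\mathbf{j}|=1}^\infty$ run over all $\mathbf{j}\in\mathbb{N}^{d_1}\setminus\{\mathbf{0}\}$. Given $\mathbf{n}\in\mathbb{N}^{d_1}$ and $\mathbf{k}\in\mathbb{N}^{d_2}$, let $K_{\mathbf{n},\mathbf{k}}$ be the set of functions $\mathbb{N}^{d_1}\setminus\{\mathbf{0}\}\to\mathbb{N}^{d_2}$, $\mathbf{j}\mapsto\mathbf{k}_{\mathbf{j}}$, satisfying $\sum_{|\mathbf{j}|=1}^\infty\mathbf{j}\,|\mathbf{k}_{\mathbf{j}}|=\mathbf{n}$ and $\sum_{|\mathbf{j}|=1}^\infty\mathbf{k}_{\mathbf{j}}=\mathbf{k}$ (such functions have finite support). For a family of vectors $\mathbf{x}_{\mathbf{j}}\in\mathbb{F}^{d_2}$ indexed by $\mathbf{j}\in\mathbb{N}^{d_1}\setminus\{\mathbf{0}\}$,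 $$\mathcal{B}_{\mathbf{n},\mathbf{k}}(\mathbf{x}_{\mathbf{j}};\mathbf{j})=\mathbf{n}!\sum_{(\mathbf{k}_{\mathbf{j}})\in K_{\mathbf{n},\mathbf{k}}}\ \prod_{|\mathbf{j}|=1}^\infty\frac{1}{\mathbf{k}_{\mathbf{j}}!}\left(\frac{\mathbf{x}_{\mathbf{j}}}{\mathbf{j}!}\right)^{\mathbf{k}_{\mathbf{j}}}.$$ *)

(* Defs.v *)
From HB Require Import structures.
From mathcomp Require Import all_boot all_order all_algebra.
From mathcomp Require Import all_classical all_reals all_analysis.
From mathcomp Require Import complex.
Set Implicit Arguments.
Unset Strict Implicit.
Unset Printing Implicit Defensive.
Import Order.TTheory GRing.Theory Num.Theory.
Import numFieldNormedType.Exports.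
Local Open Scope classical_set_scope.
Local Open Scope ring_scope.

Notation mindex d := {ffun 'I_d -> nat}.

Notation mindex_neq0 d := {j : mindex d | j != 0}.

Definition mdeg d (n : mindex d) : nat := (\sum_(i < d) n i)%N.

Definition mfact d (n : mindex d) : nat := (\prod_(i < d) (n i)`!)%N.

Definition mpow (F : numFieldType) d (x : 'rV[F]_d) (n : mindex d) : F :=
  \prod_(i < d) x 0 i ^+ n i.

Section scalar_derivatives.
Context {F : numFieldType} {d : nat}.
Implicit Types f : 'rV[F]_d -> F.

Definition partial (i : 'I_d) f : 'rV[F]_d -> F :=
  fun x => 'D_(delta_mx 0 i) f x.

(* The head of [s] is the outermost derivative. *)
Definition partials (s : seq 'I_d) f : 'rV[F]_d -> F := foldr partial f s.

(* ['D_v f x] is a total operation; this predicate says that the iterated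
   partial derivative [partials s f] genuinely exists at [x]. *)
Fixpoint partials_exist (s : seq 'I_d) f (x : 'rV[F]_d) : Prop :=
  if s is i :: s' then
    (\forall y \near x, partials_exist s' f y) /\
    derivable (partials s' f) x (delta_mx 0 i)
  else True.

(* 0, .., 0 (n_0 times), 1, .., 1 (n_1 times), .. *)
Definition mindex_seq (n : mindex d) : seq 'I_d :=
  flatten [seq nseq (n i) i | i <- enum 'I_d].

(* [f] is [k] times (Frechet) differentiable at [x]: for k >= 2 this requires
   [f] to be k - 1 times differentiable on a neighbourhood of [x]. Continuity
   of the derivatives of order [k] is not required. Neighbourhoods are taken in
   the whole space, so that on an open set only the values of [f] on that set
   matter. *)
Fixpoint times_differentiable (k : nat) f (x : 'rV[F]_d) : Prop :=
  if k is k'.+1 then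
    [/\ differentiable f x,
        \forall y \near x, times_differentiable k' f y
      & forall i, times_differentiable k' (partial i f) x]
  else True.

End scalar_derivatives.

Section vector_derivatives.
Context {F : numFieldType} {d m : nat}.
Implicit Types f : 'rV[F]_d -> 'rV[F]_m.

Definition mderive (n : mindex d) f (x : 'rV[F]_d) : 'rV[F]_m :=
  \row_l partials (mindex_seq n) (fun y => f y 0 l) x.

Definition mderivable (n : mindex d) f (x : 'rV[F]_d) : Prop :=
  forall l, partials_exist (mindex_seq n) (fun y => f y 0 l) x.

Definition vtimes_differentiable (k : nat) f (x : 'rV[F]_d) : Prop :=
  forall l, times_differentiable k (fun y => f y 0 l) x.

End vector_derivatives.

(* Sums and products over [j \in setT] are finitely supported big operators,
   which return the neutral element when the support is infinite. A family of
   natural numbers with a finite sum has finite support, so the first condition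
   only excludes this default value. *)
Definition bell_index d1 d2 (n : mindex d1) (k : mindex d2) :
    set (mindex_neq0 d1 -> mindex d2) :=
  [set kk | [/\ finite_set [set j | kk j != 0],
                \sum_(j \in setT) (val j *+ mdeg (kk j)) = n
              & \sum_(j \in setT) kk j = k]].

(* [bell_index n k] is finite, and so is the support of each product below,
   since the factor of [j] is 1 when [kk j = 0]. *)
Definition bell (F : numFieldType) d1 d2 (n : mindex d1) (k : mindex d2)
    (x : mindex_neq0 d1 -> 'rV[F]_d2) : F :=
  (mfact n)%:R *
  \sum_(kk \in bell_index n k)
    \big[*%R/1]_(j \in setT)
      ((mfact (kk j))%:R^-1 * mpow ((mfact (val j))%:R^-1 *: x j) (kk j)).

(* Main.v *)
Require Import Defs.
From HB Require Import structures.
From mathcomp Require Import all_boot all_order all_algebra.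
From mathcomp Require Import all_classical all_reals all_analysis.
From mathcomp Require Import complex.
Set Implicit Arguments.
Unset Strict Implicit.
Unset Printing Implicit Defensive.
Import Order.TTheory GRing.Theory Num.Theory.
Import numFieldNormedType.Exports.
Local Open Scope classical_set_scope.
Local Open Scope ring_scope.

(* Differentiating the induction hypothesis
     D^n (f o g) = n! \sum_kk w(kk) f^(tot kk)(g),
     w(kk) = \prod_(j, l) (g_l^(j) / j!)^(kk_j,l) / (kk_j,l)!,
   once more gives two kinds of terms, according to whether the derivative hits
   f^(tot kk)(g) or a factor of w(kk); both are sums of
   w(kk) f^(tot kk + e_l)(g) over the [kk] with \sum_j j |kk_j| + a = n, for
   a = 0 or a = j.  Counting the i-th coordinate of \sum_j j |kk_j| = n + e_i
   (Euler's identity) writes (n_i + 1) times the claimed formula for n + e_i as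
   the same combination of such sums.

   Continuity of the highest derivatives is not assumed, so the symmetry of
   mixed partial derivatives is needed in Young's form: [f] differentiable near
   x, with partial derivatives differentiable at x.  It follows from the mean
   value inequality along real segments, which holds over both fields. *)

(** * Symmetry of second derivatives over the reals and the complexes *)

(* The case distinction on [F] is only used here: the rest of the argument
   works in any numFieldType whose nonnegative elements form a copy of the
   nonnegative reals. *)
Lemma real_embedding (R : realType) (F : numFieldType) :
  F = R :> numFieldType \/ F = R[i] :> numFieldType ->
  exists iota : {rmorphism R -> F},
    (forall r, `|iota r| = iota `|r|) /\
    (forall z : F, 0 <= z -> exists r, z = iota r).
Proof.
case=> ->; first by exists idfun; split=> // z _; exists z.
exists (real_complex R); split=> [r|[a b]].
  by rewrite normc_def /= expr0n /= addr0 sqrtr_sqr.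
by rewrite lecE /= => /andP[/eqP -> _]; exists a.
Qed.

Section mean_value_inequality.
Context {R : realType} {F : numFieldType} (iota : {rmorphism R -> F}).
Hypothesis iota_norm : forall r, `|iota r| = iota `|r|.
Hypothesis iota_surj : forall z : F, 0 <= z -> exists r, z = iota r.

Lemma le_iota : {mono iota : x y / x <= y}.
Proof.
apply: le_mono => x y xy; rewrite -subr_gt0 -rmorphB.
rewrite -[y - x]gtr0_norm ?subr_gt0// -iota_norm normr_gt0 fmorph_eq0.
by rewrite subr_eq0 gt_eqF.
Qed.

Lemma lt_iota : {mono iota : x y / x < y}.
Proof. exact/leW_mono/le_iota. Qed.

Lemma iota_pos (z : F) : 0 < z -> exists2 r, 0 < r & z = iota r.
Proof.
move=> z0; have [r zE] := iota_surj (ltW z0).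
by exists r => //; rewrite -lt_iota rmorph0 -zE.
Qed.

(** Local step of the supremum argument below: close to [a], the little-o error of the derivative
    costs at most an extra slope [e]. *)
Lemma derivable_growth {V W : normedModType F} (u : V -> W) (a v : V) (M e : F) :
  0 < e -> derivable u a v -> `|'D_v u a| <= M ->
  exists2 d, 0 < d & forall h : R, `|h| < d ->
    `|u (a + iota h *: v) - u a| <= (M + e) * iota `|h|.
Proof.
move=> e0 /derivable_nbhs /eqaddoP /(_ e e0).
move=> /nbhs_ballP[_ /iota_pos[d d0 ->]] dh uM.
exists d => // h hd.
have {}dh : `|u (iota h *: v + a) - (u a + iota h *: 'D_v u a)| <= e * `|iota h|.
  by apply: dh; rewrite /= -ball_normE/= sub0r normrN iota_norm lt_iota.
rewrite -iota_norm mulrDl.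
rewrite [a + _]addrC -[_ - u a](subrK (iota h *: 'D_v u a)).
rewrite (le_trans (ler_normD _ _))// [leLHS]addrC lerD//.
  by rewrite normrZ mulrC ler_wpM2r.
by rewrite -addrA -opprD.
Qed.

(** For each [e > 0], the points where the increment from 0 has slope at most [M + e] have a
    supremum; it is itself such a point, and the growth estimate there would pass it if it were
    smaller than [T]. *)
Lemma mean_value_inequality {W : normedModType F} (u : F -> W) (M : F) (T : R) :
  0 <= T ->
  (forall s, 0 <= s <= T -> derivable u (iota s) 1 /\ `|'D_1 u (iota s)| <= M) ->
  `|u (iota T) - u 0| <= M * iota T.
Proof.
move=> T0 du; apply/ler_addgt0Pr => e e0.
have [T00|Tneq0] := eqVneq T 0.
  by rewrite T00 rmorph0 subrr normr0 mulr0 add0r ltW.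
have Tgt0 : 0 < T by rewrite lt_def Tneq0.
have iT0 : 0 < iota T by rewrite -(rmorph0 iota) lt_iota.
(* The slack [e] on the increment is spread along the segment as a slack [e / iota T] on the
   slope. *)
suff : `|u (iota T) - u 0| <= (M + e / iota T) * iota T.
  by rewrite mulrDl divfK ?gt_eqF.
have {}e0 : 0 < e / iota T by rewrite divr_gt0.
move: (e / iota T) e0 => {}e e0.
pose S := [set s | 0 <= s <= T /\ `|u (iota s) - u 0| <= (M + e) * iota s].
have S0 : S 0 by split; rewrite ?lexx ?T0// rmorph0 subrr normr0 mulr0.
have ubS : ubound S T by move=> s [/andP[]].
have supS : has_sup S by split; [exists 0 | exists T].
set c := sup S.
have c0T : 0 <= c <= T by rewrite sup_upper_bound//= ge_sup//; exists 0.
have [dc Mc] := du _ c0T; have [d d0 dP] := derivable_growth e0 dc Mc.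
have uP h : `|h| < d ->
    `|u (iota (c + h)) - u (iota c)| <= (M + e) * iota `|h|.
  by move=> /dP; rewrite [_%:A]mulr1 rmorphD.
(* A point [s] of [S] within [d] of [c] carries the bound over to [c] itself. *)
have [s Ss cs] := sup_adherent d0 supS.
have sc : s <= c by exact: sup_upper_bound.
have M0 : 0 <= M by apply: le_trans Mc.
have Sc : `|u (iota c) - u 0| <= (M + e) * iota c.
  have [_ us] := Ss; rewrite -(subrK (u (iota s)) (u _)) -addrA.
  rewrite -[in leRHS](subrK s c) rmorphD mulrDr (le_trans (ler_normD _ _))// lerD//.
  rewrite distrC -[in X in u X - _](subrKC c s).
  rewrite -[in leRHS]opprB -[- (s - c)]ler0_norm ?subr_le0//.
  by apply: uP; rewrite ler0_norm ?subr_le0// opprB ltrBlDl -ltrBlDr.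
have [cT|Tc] := ltP c T; last first.
  suff -> : T = c by [].
  by apply/le_anti; rewrite Tc; case/andP: c0T.
(* If [c < T], the estimate at [c] puts [c + h] in [S], beyond its supremum. *)
pose h := Num.min (d / 2) (T - c).
have h0 : 0 < h by rewrite lt_min divr_gt0//= subr_gt0.
have hd : `|h| < d.
  by rewrite gtr0_norm// gt_min ltr_pdivrMr// ltr_pMr// ltr1n.
suff /(sup_upper_bound supS) : S (c + h) by rewrite /= gerDl leNgt h0.
split.
  case/andP: c0T => c0 _; rewrite addr_ge0 ?(ltW h0)//=.
  by rewrite -lerBrDl ge_min lexx orbT.
rewrite -(subrK (u (iota c)) (u (iota (c + h)))) -addrA [in leRHS](addrC c).
rewrite [in leRHS]rmorphD mulrDr (le_trans (ler_normD _ _))// lerD//.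
by rewrite -[X in _ * iota X]gtr0_norm// uP.
Qed.

Lemma derive_line_quotient {V W : normedModType F} (f : V -> W) (u b : V) (s : F) :
  (fun h : F => h^-1 *:
     (((fun s => f (s *: u + b)) \o shift s) (h *: 1) - f (s *: u + b))) =
  (fun h => h^-1 *: ((f \o shift (s *: u + b)) (h *: u) - f (s *: u + b))).
Proof. by apply/funext => h /=; rewrite [_%:A]mulr1 scalerDl addrA. Qed.

Lemma is_derive_line {V W : normedModType F} (f : V -> W) (u b : V) (s : F) :
  differentiable f (s *: u + b) ->
  is_derive s 1 (fun s => f (s *: u + b)) ('D_u f (s *: u + b)).
Proof.
move=> df; split; last by rewrite /derive derive_line_quotient.
by rewrite /derivable derive_line_quotient; exact: diff_derivable.
Qed.

(** One side of the small parallelogram is handled by the mean value inequality, the other by the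
    linear approximation of ['D_u f] at [x]. Only differentiability of ['D_u f] at the single point
    [x] enters, as Young's form requires. *)
Lemma second_difference {V W : normedModType F} (f : V -> W) (x u v : V) (e : F) :
  0 < e -> (\forall y \near x, differentiable f y) ->
  differentiable ('D_u f) x ->
  exists2 d : R, 0 < d & forall t, 0 < t < d ->
    `|f (iota t *: u + iota t *: v + x) - f (iota t *: u + x)
       - f (iota t *: v + x) + f x
       - (iota t * iota t) *: 'D_v ('D_u f) x| <= e * iota t * iota t.
Proof.
move=> e0 df ddf; rewrite deriveE//; set A := 'd ('D_u f) x.
(* The 1 keeps [C] positive when [u] and [v] vanish. With tolerance [e / (2 * C)], two linearisation
   errors at points of norm at most [t * C] add up to at most [e * t]. *)
pose C := `|u| + `|v| + 1.
have C0 : 0 < C by rewrite ltr_wpDl// addr_ge0.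
have e10 : 0 < e / (2 * C) by rewrite divr_gt0// mulr_gt0.
have /diff_locally/eqaddoP/(_ _ e10) := ddf.
move=> near_lin.
have {df} near_df : \forall h \near (0 : V), differentiable f (h + x).
  by move: df; rewrite (near_shift 0)/= subr0.
have [r /= r0 rP] := (nbhs_ballP _ _).1 (filterI near_lin near_df).
have [d d0 dE] : exists2 d, 0 < d & r / C = iota d.
  by apply: iota_pos; rewrite divr_gt0.
exists d => // t /andP[t0 td].
have it0 : 0 <= iota t by rewrite -(rmorph0 iota) le_iota ltW.
have small h : `|h| <= iota t * (`|u| + `|v|) ->
    `|'D_u f (h + x) - 'D_u f x - A h| <= e / (2 * C) * `|h| /\
    differentiable f (h + x).
  move=> hle; have [|lin dfh] := rP h.
    rewrite -ball_normE /= sub0r normrN (le_lt_trans hle)//.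
    apply: le_lt_trans (_ : _ <= iota t * C) _.
      by rewrite ler_wpM2l// lerDl.
    by rewrite -ltr_pdivlMr// dE lt_iota.
  by split=> //; move: lin; rewrite !fctE /= opprD addrA.
(* The second difference minus its main term is [w (iota t) - w 0]; the linear term in [s] makes the
   derivative of [w] small on the segment. *)
pose w (s : F) := f (s *: u + (iota t *: v + x)) - f (s *: u + x)
                  - s *: (iota t *: A v).
suff : `|w (iota t) - w 0| <= e * iota t * iota t.
  by rewrite /w !scale0r !add0r subr0 scalerA opprB !addrA;
     rewrite -2!(addrAC _ _ (- (_ *: _))) (addrAC _ (f x)).
apply: mean_value_inequality; first exact: ltW.
move=> s /andP[s0 st].
have is0 : 0 <= iota s by rewrite -(rmorph0 iota) le_iota.
have ist : iota s <= iota t by rewrite le_iota.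
have su : `|iota s *: u| <= iota t * `|u| by rewrite normrZ ger0_norm// ler_wpM2r.
have tv : `|iota t *: v| <= iota t * `|v| by rewrite normrZ ger0_norm.
have [|l1 d1] := small (iota s *: u).
  by rewrite (le_trans su)// ler_wpM2l// lerDl.
have [|l2 d2] := small (iota s *: u + iota t *: v).
  by rewrite (le_trans (ler_normD _ _))// mulrDr lerD.
have D1 := is_derive_line d1.
have D2 : is_derive (iota s) 1 (fun s => f (s *: u + (iota t *: v + x)))
    ('D_u f (iota s *: u + (iota t *: v + x))).
  by apply: is_derive_line; rewrite addrA.
have D3 : is_derive (iota s) 1 (fun s : F => s *: (iota t *: A v)) (iota t *: A v).
  by split; [exact: diff_derivable | rewrite deriveE// diff_val scale1r].
have Dw : is_derive (iota s) 1 w _ := is_deriveB (is_deriveB D2 D1) D3.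
split; first by case: Dw.
rewrite derive_val addrA.
(* By linearity of [A], the derivative of [w] is a difference of two linearisation errors of
   ['D_u f] at [x]. *)
have -> : 'D_u f (iota s *: u + iota t *: v + x) - 'D_u f (iota s *: u + x)
    - iota t *: A v =
    ('D_u f (iota s *: u + iota t *: v + x) - 'D_u f x
      - A (iota s *: u + iota t *: v))
    - ('D_u f (iota s *: u + x) - 'D_u f x - A (iota s *: u)).
  rewrite [A (_ + _)]linearD ![A (_ *: _)]linearZ /=.
  move: (_ *: A u) (_ *: A v) => q p.
  rewrite [in RHS]opprB [q - _]addrC addrACA.
  by rewrite opprB subrKA opprD [- q - p]addrC subrK.
apply: le_trans (ler_normB _ _) _; apply: le_trans (lerD l2 l1) _.
rewrite -mulrDr.
have -> : e * iota t = e / (2 * C) * (2 * C * iota t).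
  by rewrite mulrA divfK// mulf_neq0// gt_eqF.
rewrite ler_pM2l// /C.
apply: le_trans (_ : _ <= 2 * ((`|u| + `|v|) * iota t)) _; last first.
  by rewrite -mulrA ler_pM2l// ler_wpM2r// lerDl.
rewrite mulr_natl mulr2n mulrDl ![_ * iota t]mulrC.
rewrite lerD// ?(le_trans (ler_normD _ _))// ?lerD// (le_trans su)//.
by rewrite lerDl mulr_ge0.
Qed.

(** The second difference is symmetric in [u] and [v], so it cancels between the two estimates and
    leaves [t ^ 2] times the difference of the mixed derivatives, bounded by [e * t ^ 2]. *)
Lemma derive_comm {V W : normedModType F} (f : V -> W) (x u v : V) :
  (\forall y \near x, differentiable f y) ->
  differentiable ('D_u f) x -> differentiable ('D_v f) x ->
  'D_v ('D_u f) x = 'D_u ('D_v f) x.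
Proof.
move=> df du dv; apply/eqP; rewrite -subr_eq0 -normr_le0.
apply/ler_addgt0Pr => e e0; rewrite add0r.
have e20 : 0 < e / 2 by rewrite divr_gt0.
have [d d0 dP] := second_difference v e20 df du.
have [d' d'0 d'P] := second_difference u e20 df dv.
pose t := Num.min d d' / 2.
have t0 : 0 < t by rewrite divr_gt0// lt_min d0.
have t2 : t < Num.min d d' by rewrite ltr_pdivrMr// ltr_pMr ?ltr1n// lt_min d0.
have it0 : 0 < iota t by rewrite -(rmorph0 iota) lt_iota.
move: t2; rewrite lt_min => /andP[td td'].
have := dP t; rewrite t0 td => /(_ isT) l1.
have := d'P t; rewrite t0 td' => /(_ isT).
rewrite [X in f (X + x)]addrC [X in X + f x]addrAC => l2.
have := le_trans (ler_normB _ _) (lerD l2 l1).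
set S := _ + f x; rewrite [S - _ *: 'D_u _ _]addrC addrKA opprK addrC.
rewrite -scalerBr normrZ -2!mulrDl -splitr normrM.
by rewrite gtr0_norm// -mulrA [e * _]mulrC ler_pM2l// mulr_gt0.
Qed.

End mean_value_inequality.

(** * Iterated differentiability *)

Section times_differentiable_theory.
Context {F : numFieldType}.

Lemma near_eq_differentiable {V W : normedModType F} (f g : V -> W) (x : V) :
  {near x, f =1 g} -> differentiable f x -> differentiable g x.
Proof.
move=> fg df; have fgx : f x = g x := nbhs_singleton fg.
have dg : g \o shift x = cst (g x) + 'd f x +o_ 0 id.
  apply/eqaddoP => e e0; have /diff_locally/eqaddoP/(_ _ e0) := df.
  have fg0 : \forall h \near (0 : V), f (h + x) = g (h + x).
    by move: fg; rewrite [X in X -> _](near_shift 0)/= subr0.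
  by apply: filterS2 fg0 => h fgh; rewrite !fctE /= fgh fgx.
have dE := diff_unique (diff_continuous df) dg.
by apply/diff_locallyP; rewrite dE; split => //; exact: diff_continuous.
Qed.

Lemma differentiable_row {V : normedModType F} m (g : V -> 'rV[F]_m) (x : V) :
  (forall l, differentiable (fun y => g y 0 l) x) -> differentiable g x.
Proof.
move=> dg; have -> : g = \sum_l (fun y => g y 0 l *: delta_mx 0 l).
  by apply/funext => y; rewrite fct_sumE -row_sum_delta.
by apply: differentiable_sum => l; exact: differentiableZl.
Qed.

Lemma diff_row {V : normedModType F} m (g : V -> 'rV[F]_m) (x v : V) l :
  differentiable g x -> 'd g x v 0 l = 'd (fun y => g y 0 l) x v.
Proof.
move=> dg.
have coord_linear : linear (fun N : 'rV[F]_m => N 0 l).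
  by move=> a M N; rewrite !mxE.
pose coordM := GRing.isLinear.Build _ _ _ _ _ coord_linear.
pose coord : {linear 'rV[F]_m -> F} := HB.pack (fun N : 'rV[F]_m => N 0 l) coordM.
have coord_cont : continuous coord by exact: coord_continuous.

have dc := linear_differentiable (g x) coord_cont.
have : 'd (coord \o g) x v = 'd coord (g x) ('d g x v).
  by rewrite (diff_comp dg dc).
by rewrite (diff_lin (g x) coord_cont) => dE; exact: esym dE.
Qed.

Lemma derive_comp_row {V : normedModType F} m (f : 'rV[F]_m -> F)
    (g : V -> 'rV[F]_m) (x v : V) :
  (forall l, differentiable (fun y => g y 0 l) x) -> differentiable f (g x) ->
  'D_v (f \o g) x = \sum_l partial l f (g x) * 'D_v (fun y => g y 0 l) x.
Proof.
move=> dgl df; have dg := differentiable_row dgl.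
rewrite deriveE; last exact: differentiable_comp.
rewrite diff_comp//= [X in 'd f _ X]row_sum_delta linear_sum/=.
apply: eq_bigr => l _; rewrite linearZ/= diff_row// -!deriveE// mulrC.
by rewrite /partial.
Qed.

Lemma near_eq_partials d (s : seq 'I_d) (f g : 'rV[F]_d -> F) (x : 'rV[F]_d) :
  {near x, f =1 g} -> {near x, partials s f =1 partials s g}.
Proof.
move=> fg; elim: s => //= i s /near_join; apply: filterS => y.
exact: near_eq_derive.
Qed.

(** The sum, product and chain rules give the partial derivatives only where the functions are
    differentiable, hence only near [x]; this lemma lets them be substituted nevertheless. *)
Lemma near_eq_times_differentiable d k (f g : 'rV[F]_d -> F) (x : 'rV[F]_d) :
  {near x, f =1 g} -> times_differentiable k f x -> times_differentiable k g x.
Proof.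
elim: k f g x => // k IHk f g x fg [dfx nf pf]; split.
- exact: near_eq_differentiable dfx.
- by apply: filterS2 (near_join fg) nf => y; exact: IHk.
- move=> i; apply: IHk (pf i).
  exact: (near_eq_partials [:: i] fg).
Qed.

Lemma times_differentiable_le d m k (f : 'rV[F]_d -> F) (x : 'rV[F]_d) :
  (m <= k)%N -> times_differentiable k f x -> times_differentiable m f x.
Proof.
elim: k m f x => [|k IHk] [|m] f x //; rewrite ltnS => mk [dfx nf pf]; split=> //.
- by apply: filterS nf => y; exact: IHk.
- by move=> i; exact: IHk (pf i).
Qed.

Lemma near_differentiable d k (f : 'rV[F]_d -> F) (x : 'rV[F]_d) :
  times_differentiable k.+2 f x -> \forall y \near x, differentiable f y.
Proof. by case=> _ nf _; apply: filterS nf => y []. Qed.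

Lemma times_differentiable_partials d k (s : seq 'I_d) (f : 'rV[F]_d -> F)
    (x : 'rV[F]_d) :
  times_differentiable (size s + k) f x -> times_differentiable k (partials s f) x.
Proof.
(* [times_differentiable] peels off the derivative applied first, which is the last entry of the
   list. *)
elim/last_ind: s f => //= s i IHs f; rewrite size_rcons addSn => -[_ _ pf].
by rewrite /partials foldr_rcons; exact: IHs (pf i).
Qed.

Lemma times_differentiable_exist d (s : seq 'I_d) (f : 'rV[F]_d -> F)
    (x : 'rV[F]_d) :
  times_differentiable (size s) f x -> partials_exist s f x.
Proof.
elim: s f x => //= i s IHs f x tf; split.
  by case: tf => _ nf _; apply: filterS nf => y; exact: IHs.
have [] : times_differentiable 1 (partials s f) x.
  by apply: times_differentiable_partials; rewrite addn1.
by move=> df _ _; exact: diff_derivable.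
Qed.

Lemma times_differentiable_cst d k (a : F) (x : 'rV[F]_d) :
  times_differentiable k (cst a) x.
Proof.
elim: k a x => //= k IHk a x; split=> // [|i].
  by apply: filterE => y; exact: IHk.
suff -> : partial i (cst a) = cst 0 by [].
by apply/funext => y; exact: derive_cst.
Qed.

Lemma times_differentiableD d k (f g : 'rV[F]_d -> F) (x : 'rV[F]_d) :
  times_differentiable k f x -> times_differentiable k g x ->
  times_differentiable k (f + g) x.
Proof.
elim: k f g x => // k IHk f g x tf tg.
have [dfx nf pf] := tf; have [dgx ng pg] := tg; split.
- exact: differentiableD.
- by apply: filterS2 nf ng => y; exact: IHk.
(* At order 1 nothing is asked of the partial derivatives. From order 2 on, both functions are
   differentiable near [x], so the sum rule holds on a neighbourhood. *)
case: k => [//|k] in IHk tf tg nf ng pf pg * => i.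
apply: near_eq_times_differentiable (IHk _ _ _ (pf i) (pg i)).
apply: filterS2 (near_differentiable tf) (near_differentiable tg) => y dfy dgy.
by rewrite /partial deriveD//; exact: diff_derivable.
Qed.

Lemma times_differentiable_sum d k m (f : 'I_m -> 'rV[F]_d -> F) (x : 'rV[F]_d) :
  (forall l, times_differentiable k (f l) x) ->
  times_differentiable k (\sum_l f l) x.
Proof.
move=> tf; elim/big_ind: _ => [|f1 f2|l _]; last exact: tf.
- exact: times_differentiable_cst.
- exact: times_differentiableD.
Qed.

Lemma times_differentiableM d k (f g : 'rV[F]_d -> F) (x : 'rV[F]_d) :
  times_differentiable k f x -> times_differentiable k g x ->
  times_differentiable k (f * g) x.
Proof.
elim: k f g x => // k IHk f g x tf tg.
have [dfx nf pf] := tf; have [dgx ng pg] := tg; split.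
- exact: differentiableM.
- by apply: filterS2 nf ng => y; exact: IHk.
case: k => [//|k] in IHk tf tg nf ng pf pg * => i.
apply: (@near_eq_times_differentiable _ _ (f * partial i g + g * partial i f)).
  apply: filterS2 (near_differentiable tf) (near_differentiable tg) => y dfy dgy.
  by rewrite /partial deriveM//; exact: diff_derivable.
(* The product rule leaves one factor of each term undifferentiated; its order is lowered to match
   the induction hypothesis. *)
have tf' := times_differentiable_le (leqnSn _) tf.
have tg' := times_differentiable_le (leqnSn _) tg.
by apply: times_differentiableD; exact: IHk.
Qed.

Lemma vtimes_differentiable_continuous d m k (g : 'rV[F]_d -> 'rV[F]_m)
    (x : 'rV[F]_d) :
  vtimes_differentiable k.+1 g x -> {for x, continuous g}.
Proof.
move=> tg; apply: differentiable_continuous; apply: differentiable_row => l.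
by case: (tg l).
Qed.

Lemma near_vtimes_differentiable d m k (g : 'rV[F]_d -> 'rV[F]_m)
    (x : 'rV[F]_d) :
  vtimes_differentiable k.+1 g x -> \forall y \near x, vtimes_differentiable k g y.
Proof.
move=> tg; apply: (@filter_forall _ _
  (fun l y => times_differentiable k (fun y => g y 0 l) y) (nbhs x)) => l.
by case: (tg l).
Qed.

(** The chain rule writes each partial derivative near [x] as a sum of products to which the
    induction hypothesis applies; continuity of [g] pulls neighbourhoods of [g x] back to [x]. *)
Lemma times_differentiable_comp d m k (g : 'rV[F]_d -> 'rV[F]_m)
    (f : 'rV[F]_m -> F) (x : 'rV[F]_d) :
  vtimes_differentiable k g x -> times_differentiable k f (g x) ->
  times_differentiable k (f \o g) x.
Proof.
elim: k f g x => // k IHk f g x tg tf.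
have gc := vtimes_differentiable_continuous tg.
have dg : differentiable g x by apply: differentiable_row => l; case: (tg l).
have [dfx nf pf] := tf; split.
- exact: differentiable_comp.
- by apply: filterS2 (near_vtimes_differentiable tg) (gc _ nf) => y; exact: IHk.
case: k => [//|k] in IHk tf tg nf pf * => i.
apply: (@near_eq_times_differentiable _ _
  (\sum_l (partial l f \o g) * partial i (fun y => g y 0 l))).
  have ng := near_vtimes_differentiable tg.
  apply: filterS2 ng (gc _ (near_differentiable tf)) => y tgy dfy.
  rewrite fct_sumE /partial [RHS]derive_comp_row// => l.
  by case: (tgy l).
apply: times_differentiable_sum => l; apply: times_differentiableM.
  apply: IHk (pf l) => l'; exact: times_differentiable_le (tg l').
by case: (tg l) => _ _ pg; exact: pg.
Qed.

Hypothesis derive_comm : forall d (f : 'rV[F]_d -> F) (x u v : 'rV[F]_d),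
  (\forall y \near x, differentiable f y) ->
  differentiable ('D_u f) x -> differentiable ('D_v f) x ->
  'D_v ('D_u f) x = 'D_u ('D_v f) x.

Lemma partial_comm d (i j : 'I_d) (f : 'rV[F]_d -> F) (x : 'rV[F]_d) :
  times_differentiable 2 f x -> partial i (partial j f) x = partial j (partial i f) x.
Proof.
move=> tf; have [_ _ pf] := tf; apply: derive_comm (near_differentiable tf) _ _.
  by case: (pf j).
by case: (pf i).
Qed.

(** The head [i] of [s] is located in [t] and moved to the front by swaps of neighbours. Each
    rewriting below an outer derivative needs an equality near [x], and the spare order of
    differentiability provides it. *)
Lemma partials_perm d (s t : seq 'I_d) (f : 'rV[F]_d -> F) (x : 'rV[F]_d) :
  perm_eq s t -> times_differentiable (size s) f x -> partials s f x = partials t f x.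
Proof.
elim: s t f x => [|i s IHs] t f x.
  by rewrite perm_sym => /perm_nilP ->.
move=> ist tf; have it : i \in t by rewrite -(perm_mem ist) mem_head.
case/splitPr: it ist => t1 t2 ist.
have {ist} st : perm_eq s (t1 ++ t2).
  by rewrite -(perm_cons i) (perm_trans ist)// perm_catC /= perm_cons perm_catC.
have -> : partials (i :: s) f x = partials (i :: t1 ++ t2) f x.
  apply: near_eq_derive; case: tf => _ nf _.
  by apply: filterS nf => y; exact: IHs.
have {tf st} : times_differentiable (size (t1 ++ t2)).+1 f x.
  by rewrite -(perm_size st).
(* Here [i] travels through [t1], one transposition with [j] at a time. *)
elim: t1 x => [//|j t1 IHt] x /= tf.
transitivity (partials (j :: i :: t1 ++ t2) f x).
  by apply: partial_comm; apply: times_differentiable_partials; rewrite addn2.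
apply: near_eq_derive; case: tf => _ nf _.
by apply: filterS nf => y; exact: IHt.
Qed.

End times_differentiable_theory.

(** * Multi-indices *)

Section multi_indices.
Context {d : nat}.
Implicit Types (n m : mindex d) (i : 'I_d) (s : seq 'I_d).

Definition munit i : mindex d := [ffun j => (j == i) : nat].

Definition mcount s : mindex d := [ffun i => count_mem i s].

Lemma mindexMnE n k i : (n *+ k) i = (n i * k)%N.
Proof. by rewrite ffunMnE -mulr_natr natn. Qed.

Lemma mindex_addIn n : injective (fun m => m + n).
Proof.
move=> a b /= /ffunP abn; apply/ffunP => i; apply: (@addIn (n i)).
by have := abn i; rewrite !ffunE.
Qed.

Lemma mindex_pred n i : n i != 0%N -> exists m, n = m + munit i.
Proof.
move=> ni; exists [ffun j => (n j - (j == i))%N]; apply/ffunP => j.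
rewrite !ffunE [RHS]subnK//; case: eqP => // ->.
by rewrite lt0n.
Qed.

Lemma mdeg0 : mdeg (0 : mindex d) = 0%N.
Proof. by rewrite /mdeg big1// => i _; rewrite ffunE. Qed.

Lemma mdegD n m : mdeg (n + m) = (mdeg n + mdeg m)%N.
Proof. by rewrite /mdeg -big_split; apply: eq_bigr => i _; rewrite ffunE. Qed.

Lemma mdegMn n k : mdeg (n *+ k) = (mdeg n * k)%N.
Proof. by rewrite /mdeg big_distrl; apply: eq_bigr => i _; rewrite mindexMnE. Qed.

Lemma mdeg_sum (I : Type) (r : seq I) (f : I -> mindex d) :
  mdeg (\sum_(j <- r) f j) = (\sum_(j <- r) mdeg (f j))%N.
Proof.
by elim/big_rec2: _ => [|j m n _ <-]; rewrite ?mdeg0 ?mdegD.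
Qed.

Lemma mdeg_gt0 n : (0 < mdeg n)%N = (n != 0).
Proof.
apply/idP/idP; first by apply: contraTneq => ->; rewrite mdeg0.
apply: contraR; rewrite -eqn0Ngt /mdeg sum_nat_eq0 => /forallP n0.
by apply/eqP/ffunP => i; rewrite ffunE; apply/eqP/(implyP (n0 i)).
Qed.

Lemma leq_mdeg n i : (n i <= mdeg n)%N.
Proof. by rewrite /mdeg (bigD1 i)//= leq_addr. Qed.

Lemma mdeg_munit i : mdeg (munit i) = 1%N.
Proof.
rewrite /mdeg (bigD1 i)//= ffunE eqxx big1 ?addn0// => j ji.
by rewrite ffunE (negbTE ji).
Qed.

Lemma mfact0 : mfact (0 : mindex d) = 1%N.
Proof. by rewrite /mfact big1// => i _; rewrite ffunE. Qed.

Lemma mfactD1 n i : mfact (n + munit i) = ((n i).+1 * mfact n)%N.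
Proof.
rewrite /mfact (bigD1 i)//= [in RHS](bigD1 i)//= !ffunE eqxx [(_ + _)%R]addn1.
rewrite factS mulnA; congr muln; apply: eq_bigr => j ji.
by rewrite !ffunE (negbTE ji) [(_ + _)%R]addn0.
Qed.

Lemma mcount_cons i s : mcount (i :: s) = mcount s + munit i.
Proof. by apply/ffunP => j; rewrite !ffunE/= addnC eq_sym. Qed.

Lemma mdeg_mcount s : mdeg (mcount s) = size s.
Proof.
elim: s => [|i s IHs]; last by rewrite mcount_cons mdegD mdeg_munit IHs addn1.
by rewrite /mdeg big1// => i _; rewrite ffunE.
Qed.

Lemma mcount_mindex_seq n : mcount (mindex_seq n) = n.
Proof.
apply/ffunP => i; rewrite ffunE /mindex_seq count_flatten sumnE 2!big_map.
rewrite big_enum/= (bigD1 i)//= count_nseq/= eqxx mul1n big1 ?addn0// => j ji.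
by rewrite count_nseq/= (negbTE ji).
Qed.

Lemma size_mindex_seq n : size (mindex_seq n) = mdeg n.
Proof. by rewrite -mdeg_mcount mcount_mindex_seq. Qed.

Lemma perm_mindex_seq s n : mcount s = n -> perm_eq (mindex_seq n) s.
Proof.
move=> sn; apply/allP => i _; apply/eqP.
transitivity (mcount (mindex_seq n) i); first by rewrite ffunE.
by rewrite mcount_mindex_seq -sn ffunE.
Qed.

Lemma finite_mdeg_le (N : nat) : finite_set [set n : mindex d | (mdeg n <= N)%N].
Proof.
pose unbound (h : {ffun 'I_d -> 'I_N.+1}) : mindex d := [ffun i => h i : nat].
apply: sub_finite_set (finite_image unbound (finite_finset (X := setT))).
move=> n /= nN; exists [ffun i => inord (n i)] => //.
apply/ffunP => i; rewrite !ffunE inordK// ltnS.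
exact: leq_trans (leq_mdeg n i) nN.
Qed.

(** Such a list replaces the infinite range of [j]: no [j] of degree above [|n|] occurs in a Bell
    term of index [n]. *)
Lemma low_degree_seq (N : nat) :
  exists2 r : seq (mindex_neq0 d), uniq r & forall j, (j \in r) = (mdeg (val j) <= N)%N.
Proof.
pose s : seq (mindex d) :=
  finmap.enum_fset (fset_set [set n : mindex d | (mdeg n <= N)%N]).
exists (pmap insub s); first exact/pmap_sub_uniq/finmap.fset_uniq.
move=> j; rewrite mem_pmap_sub in_fset_set; last exact: finite_mdeg_le.
by apply/idP/idP; rewrite inE.
Qed.

End multi_indices.

(** * Recursion for sums of Bell terms *)

Section divided_powers.
Context {F : numFieldType}.

Definition dpow (c : F) (m : nat) : F := c ^+ m / m`!%:R.

(** The derivative of [dpow c m] in [c]: divided powers drop by one index without a numerical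
    factor. *)
Definition dpow' (c : F) (m : nat) : F := if m is m'.+1 then dpow c m' else 0.

Lemma mul_dpow' c m : c * dpow' c m = m%:R * dpow c m.
Proof.
case: m => [|m] /=; first by rewrite mulr0 mul0r.
rewrite /dpow factS natrM exprS invfM [RHS]mulrCA mulVKf ?pnatr_eq0//.
by rewrite mulrA.
Qed.

End divided_powers.

Lemma eq_big_support (I : eqType) (V : nmodType) (s t : seq I) (G : I -> V) :
  uniq s -> uniq t -> (forall x, G x != 0 -> (x \in s) = (x \in t)) ->
  \sum_(x <- s) G x = \sum_(x <- t) G x.
Proof.
move=> us ut st.
rewrite (bigID (fun x => G x != 0))/= [RHS](bigID (fun x => G x != 0))/=.
rewrite !(big1 _ (fun x => ~~ (G x != 0))) ?addr0; do ?by move=> x /negPn/eqP.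
rewrite -big_filter -[RHS]big_filter; apply: perm_big.
rewrite uniq_perm ?filter_uniq// => x; rewrite !mem_filter.
by case: (boolP (G x != 0)) => //= Gx; rewrite st.
Qed.

Section bell_sums.
Context {d1 d2 : nat} {F : numFieldType} (N : nat) (r : seq (mindex_neq0 d1)).
Hypotheses (r_uniq : uniq r)
  (rE : forall j, (j \in r) = (mdeg (val j) <= N)%N).
Implicit Types (kk : mindex_neq0 d1 -> mindex d2) (j : mindex_neq0 d1)
  (l : 'I_d2) (a n : mindex d1) (p : mindex_neq0 d1 * 'I_d2).

Definition weight kk : mindex d1 := \sum_(j <- r) (val j *+ mdeg (kk j)).

Definition vtotal kk : mindex d2 := \sum_(j <- r) kk j.

(* The multiplicity functions counting the vector partitions of [n - a]; adding
   [a] on the left avoids the truncated subtraction. *)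
Definition vpartitions a n : set (mindex_neq0 d1 -> mindex d2) :=
  [set kk | (forall j, j \notin r -> kk j = 0) /\ weight kk + a = n].

Lemma leq_mdeg_weight kk j :
  j \in r -> (mdeg (val j) * mdeg (kk j) <= mdeg (weight kk))%N.
Proof.
move=> jr; rewrite mdeg_sum (bigD1_seq j)//= mdegMn.
exact: leq_addr.
Qed.

(** Each part [val j] has degree at least 1. Hence the sum over [k] may stop at [|n|]. *)
Lemma mdeg_vtotal a n kk :
  vpartitions a n kk -> (mdeg (vtotal kk) + mdeg a <= mdeg n)%N.
Proof.
move=> [_ <-]; rewrite mdegD leq_add2r !mdeg_sum; apply: leq_sum => j _.
by rewrite mdegMn leq_pmull// mdeg_gt0 (valP j).
Qed.

Lemma vpartitions_supp a n kk j : vpartitions a n kk -> kk j != 0 ->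
  (mdeg (val j) + mdeg a <= mdeg n)%N.
Proof.
move=> [kk0 <-] kkj; have jr : j \in r by apply: contraNT kkj => /kk0/eqP.
rewrite mdegD leq_add2r (leq_trans _ (leq_mdeg_weight kk jr))//.
by rewrite leq_pmulr// mdeg_gt0.
Qed.

Lemma finite_vpartitions a n : finite_set (vpartitions a n).
Proof.
pose K := {ffun 'I_(size r) -> {ffun 'I_d2 -> 'I_(mdeg n).+1}}.
(* For [j] outside [r], [index j r] is [size r], which [insub] rejects; the decoded function is then
   0, as membership demands. *)
pose unbound (h : K) : mindex_neq0 d1 -> mindex d2 := fun j =>
  if insub (index j r) is Some i then [ffun l => h i l : nat] else 0.
apply: sub_finite_set (finite_image unbound (finite_finset (X := setT))).
move=> kk kkn; have [kk0 kkE] := kkn.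
have kk_le j l : (kk j l <= mdeg n)%N.
  rewrite (leq_trans (leq_mdeg _ _))//.
  have [jr|/kk0 ->] := boolP (j \in r); last by rewrite mdeg0.
  rewrite -kkE mdegD (leq_trans _ (leq_addr _ _))//.
  rewrite (leq_trans _ (leq_mdeg_weight kk jr))// leq_pmull//.
  by rewrite mdeg_gt0 (valP j).
exists [ffun i => [ffun l => inord (kk (tnth (in_tuple r) i) l)]] => //.
apply/funext => j; rewrite /unbound; case: insubP => [i ir ij|]; last first.
  by rewrite index_mem => /kk0.
apply/ffunP => l; rewrite !ffunE inordK ?ltnS//.
by rewrite (tnth_nth j)/= ij nth_index// -index_mem.
Qed.

Definition incr j l kk : mindex_neq0 d1 -> mindex d2 :=
  fun j' => if j' == j then kk j + munit l else kk j'.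

Lemma weight_incr j l kk : j \in r -> weight (incr j l kk) = weight kk + val j.
Proof.
move=> jr; rewrite /weight (bigD1_seq j)//= [in RHS](bigD1_seq j)//=.
rewrite addrAC /incr eqxx mdegD mdeg_munit addn1 mulrSr; congr (_ + _).
by apply: eq_bigr => j' /negbTE ->.
Qed.

Lemma vtotal_incr j l kk : j \in r -> vtotal (incr j l kk) = vtotal kk + munit l.
Proof.
move=> jr; rewrite /vtotal (bigD1_seq j)//= [in RHS](bigD1_seq j)//=.
rewrite addrAC /incr eqxx; congr (_ + _).
by apply: eq_bigr => j' /negbTE ->.
Qed.

(** Removing one copy of the part [j] of colour [l] is the inverse; the lost weight is the offset
    [val j]. *)
Lemma incr_bij j l n : j \in r ->
  set_bij (vpartitions (val j) n) (vpartitions 0 n `&` [set kk | kk j l != 0%N])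
    (incr j l).
Proof.
move=> jr; split.
- move=> kk [kk0 kkE]; split;
    last by rewrite /= /incr eqxx !ffunE eqxx [(_ + _)%R]addn1.
  split; last by rewrite weight_incr// addr0.
  by move=> j' j'r; rewrite /incr; case: eqP j'r => [->|_ /kk0//]; rewrite jr.
- move=> kk kk' _ _ ekk; apply/funext => j'.
  have := congr1 (fun h => h j') ekk; rewrite /incr; case: eqP => // ->.
  exact: mindex_addIn.
- move=> kk [[kk0 kkE] /= kkjl].
  have [m kkjE] := mindex_pred kkjl.
  pose kk' j' := if j' == j then m else kk j'.
  have kkK : incr j l kk' = kk.
    by apply/funext => j'; rewrite /incr /kk' eqxx; case: eqP => // ->.
  exists kk' => //; split; last by rewrite -(weight_incr l)// kkK -kkE addr0.
  by move=> j' j'r; rewrite /kk'; case: eqP j'r => [->|_ /kk0//]; rewrite jr.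
Qed.

Definition vpairs := [seq (j, l) | j <- r, l <- enum 'I_d2].

Lemma vpairs_uniq : uniq vpairs.
Proof. by apply: allpairs_uniq => //; [exact: enum_uniq|move=> [? ?] [? ?]]. Qed.

#[local] Hint Resolve vpairs_uniq : core.

Lemma mem_vpairs j l : ((j, l) \in vpairs) = (j \in r).
Proof.
apply/allpairsP/idP => [[[j' l'] [/= j'r _ [-> _]]]//|jr].
by exists (j, l); split => //; rewrite mem_enum.
Qed.

Implicit Types c : mindex_neq0 d1 -> 'I_d2 -> F.

Definition bell_term c kk : F := \prod_(p <- vpairs) dpow (c p.1 p.2) (kk p.1 p.2).

(** The partial derivative of [bell_term c kk] in the variable [c p.1 p.2]. *)
Definition bell_term' c kk p : F :=
  dpow' (c p.1 p.2) (kk p.1 p.2) *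
  \prod_(q <- vpairs | q != p) dpow (c q.1 q.2) (kk q.1 q.2).

Lemma mul_bell_term' c kk p : p \in vpairs ->
  c p.1 p.2 * bell_term' c kk p = (kk p.1 p.2)%:R * bell_term c kk.
Proof.
move=> pP; rewrite /bell_term' mulrA mul_dpow' /bell_term (bigD1_seq p)//=.
exact: esym (mulrA _ _ _).
Qed.

Lemma bell_term'_incr c kk p : p \in vpairs ->
  bell_term' c (incr p.1 p.2 kk) p = bell_term c kk.
Proof.
move=> pP; rewrite /bell_term' /bell_term [in RHS](bigD1_seq p)//=; congr (_ * _).
  by rewrite /incr eqxx !ffunE eqxx [(_ + _)%R]addn1.
apply: eq_bigr => -[j l]; rewrite /incr/= -pair_eqE /=.
case: (j =P p.1) => [->|//]; rewrite /= => /negbTE lp.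
by rewrite !ffunE lp [(_ + _)%R]addn0.
Qed.

(** The function [phi] stands for the derivatives of [f] at [g x]; it is left arbitrary because
    differentiating them shifts its argument by a unit multi-index. *)
Definition bell_sum c (phi : mindex d2 -> F) a n : F :=
  \sum_(kk \in vpartitions a n) bell_term c kk * phi (vtotal kk).

(** Terms with [kk j l = 0] vanish since [dpow'] is 0 there; on the others [incr] undoes the
    derivative. *)
Lemma sum_bell_term' c phi n p : p \in vpairs ->
  \sum_(kk \in vpartitions 0 n) bell_term' c kk p * phi (vtotal kk) =
  bell_sum c (fun k => phi (k + munit p.2)) (val p.1) n.
Proof.
case: p => j l pP; have jr : j \in r by rewrite -(mem_vpairs j l).
rewrite -(@fsbig_widen _ _ _ _ (vpartitions 0 n `&` [set kk | kk j l != 0%N])).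
- rewrite (@reindex_fsbig _ _ _ _ _ (incr j l) (vpartitions (val j) n))//;
    last exact: incr_bij.
  apply: eq_fsbigr => kk _.
  by rewrite (bell_term'_incr c kk pP) vtotal_incr.
- by move=> kk [].
- move=> kk [kkn /not_andP[//|/negP/negPn/eqP kkjl]].
  by rewrite /= /bell_term' /= kkjl !mul0r.
Qed.

Lemma mem_low_degree a : (a \in map val r) = (a != 0) && (mdeg a <= N)%N.
Proof.
apply/mapP/andP => [[j jr ->]|[a0 aN]]; first by rewrite -rE (valP j).
by exists (Sub a a0); rewrite // rE.
Qed.

Lemma vpartitionsD a b n : vpartitions (a + b) (n + b) = vpartitions a n.
Proof.
apply/seteqP; split=> kk [kk0 kkE]; split=> //; last by rewrite addrA kkE.
by move: kkE; rewrite addrA; exact: mindex_addIn.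
Qed.

Lemma bell_sum_gt_mdeg c phi a n :
  (mdeg n < mdeg a)%N -> bell_sum c phi a n = 0.
Proof.
move=> na; apply: fsbig1 => kk /mdeg_vtotal kkn.
by have := leq_trans (leq_addl _ _) kkn; rewrite leqNgt na.
Qed.

Lemma weight_pairs kk i :
  weight kk i = (\sum_(p <- vpairs) val p.1 i * kk p.1 p.2)%N.
Proof.
rewrite /weight /vpairs big_allpairs sum_ffunE; apply: eq_bigr => j _.
by rewrite mindexMnE /mdeg big_distrr big_enum.
Qed.

(** The number [n i] counts the parts with multiplicity, weighted by their [i]-th entry, and each
    multiplicity times a term is [c] times a partial derivative by [mul_bell_term']. *)
Lemma bell_sum_euler c phi i n :
  (n i)%:R * bell_sum c phi 0 n =
  \sum_(p <- vpairs) (val p.1 i)%:R * c p.1 p.2 *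
     bell_sum c (fun k => phi (k + munit p.2)) (val p.1) n.
Proof.
have vfin := finite_vpartitions 0 n.
transitivity (\sum_(kk \in vpartitions 0 n) \sum_(p <- vpairs)
    (val p.1 i)%:R * c p.1 p.2 * (bell_term' c kk p * phi (vtotal kk))).
  rewrite /bell_sum mulr_fsumr; apply: eq_fsbigr => kk; rewrite inE => -[_ <-].
  rewrite addr0 weight_pairs natr_sum mulr_suml; apply: eq_big_seq => p pP.
  rewrite natrM -[LHS]mulrA -[RHS]mulrA; congr (_ * _).
  by rewrite [LHS]mulrA [RHS]mulrA -mul_bell_term'.
rewrite fsbig_finite// exchange_big/=; apply: eq_big_seq => p pP.
by rewrite -sum_bell_term'// [in RHS]fsbig_finite// mulr_sumr.
Qed.

(** Euler's identity at [n + munit i], with each contributing part written [b + munit i]: the factor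
    [b i + 1] cancels against the factorial. Nonzero [b] gives the first sum, [b = 0] the second. *)
Lemma bell_sum_rec (x : mindex d1 -> 'I_d2 -> F) phi i n : (mdeg n < N)%N ->
  let c j l := x (val j) l / (mfact (val j))%:R in
  (n i).+1%:R * bell_sum c phi 0 (n + munit i) =
  \sum_(p <- vpairs) x (val p.1 + munit i) p.2 / (mfact (val p.1))%:R *
     bell_sum c (fun k => phi (k + munit p.2)) (val p.1) n +
  \sum_l x (munit i) l * bell_sum c (fun k => phi (k + munit l)) 0 n.
Proof.
move=> nN c.
pose G a := \sum_l (a i)%:R * (x a l / (mfact a)%:R) *
  bell_sum c (fun k => phi (k + munit l)) a (n + munit i).
have GD a : G (a + munit i) = \sum_l x (a + munit i) l / (mfact a)%:R *
    bell_sum c (fun k => phi (k + munit l)) a n.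
  apply: eq_bigr => l _; rewrite /bell_sum vpartitionsD; congr (_ * _).
  rewrite mfactD1 !ffunE eqxx [(_ + _)%R]addn1 natrM invfM.
  by rewrite mulrCA mulVKf// pnatr_eq0.
have := bell_sum_euler c phi i (n + munit i).
rewrite !ffunE eqxx [(n i + _)%R]addn1 => ->.
transitivity (\sum_(a <- map val r) G a).
  by rewrite /vpairs big_allpairs big_map; apply: eq_bigr => j _; rewrite big_enum.
(* The two lists differ only where [G] vanishes: at [a i = 0], or at degree [N + 1], which exceeds
   the degree of [n + munit i]. *)
transitivity (\sum_(a <- map (fun a => a + munit i) (0 :: map val r)) G a).
  have low_uniq : uniq (map val r) by rewrite map_inj_uniq//; exact: val_inj.
  apply: eq_big_support => // [|a Ga].
    rewrite map_inj_uniq; last exact: mindex_addIn.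
    by rewrite /= mem_low_degree eqxx.
  have ai : a i != 0%N.
    by apply: contraNneq Ga => ai; rewrite /G big1// => l _; rewrite ai !mul0r.
  have aN : (mdeg a <= N)%N.
    rewrite leqNgt; apply: contra Ga => Na; rewrite /G big1// => l _.
    by rewrite bell_sum_gt_mdeg ?mulr0// mdegD mdeg_munit addn1 (leq_trans _ Na).
  have [b aE] := mindex_pred ai.
  rewrite mem_low_degree aN andbT.
  have -> : a != 0 by apply: contraNneq ai => ->; rewrite ffunE.
  apply/esym/mapP; exists b => //; rewrite inE mem_low_degree.
  move: aN; rewrite aE mdegD mdeg_munit addn1 => /ltnW ->.
  by rewrite andbT orbN.
rewrite big_map big_cons big_map GD addrC; congr (_ + _).
  rewrite /vpairs big_allpairs; apply: eq_bigr => j _.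
  by rewrite GD big_enum.
by apply: eq_bigr => l _; rewrite add0r mfact0 divr1.
Qed.

End bell_sums.

(** * Derivatives of sums of Bell terms *)

Section derivatives_of_sums_and_products.
Context {F : numFieldType} {V : normedModType F}.
Variables (x v : V).

Lemma is_derive_sum_seq (I : eqType) (s : seq I) (h : I -> V -> F) (dh : I -> F) :
  (forall p, p \in s -> is_derive x v (h p) (dh p)) ->
  is_derive x v (fun y => \sum_(p <- s) h p y) (\sum_(p <- s) dh p).
Proof.
elim: s => [|a s IHs] hs.
  rewrite big_nil (_ : (fun _ => _) = cst 0); first exact: is_derive_cst.
  by apply/funext => y; rewrite big_nil.
have {}IHs := IHs (fun p ps => hs p (mem_behead (s := a :: s) ps)).
have ha := hs a (mem_head _ _).
rewrite big_cons (_ : (fun _ => _) = h a + fun y => \sum_(p <- s) h p y).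
  exact: is_deriveD.
by apply/funext => y; rewrite big_cons.
Qed.

Lemma is_derive_prod_seq (I : eqType) (s : seq I) (h : I -> V -> F) (dh : I -> F) :
  uniq s -> (forall p, p \in s -> is_derive x v (h p) (dh p)) ->
  is_derive x v (fun y => \prod_(p <- s) h p y)
    (\sum_(p <- s) dh p * \prod_(q <- s | q != p) h q x).
Proof.
elim: s => [|a s IHs] /=.
  rewrite big_nil (_ : (fun _ => _) = cst 1) => [_ _|]; first exact: is_derive_cst.
  by apply/funext => y; rewrite big_nil.
move=> /andP[as_ us] hs.
have {}IHs := IHs us (fun p ps => hs p (mem_behead (s := a :: s) ps)).
have ha := hs a (mem_head _ _).
rewrite (_ : (fun _ => _) = h a * fun y => \prod_(p <- s) h p y); last first.
  by apply/funext => y; rewrite big_cons.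
apply: is_derive_eq; rewrite addrC [in RHS]big_cons; congr (_ + _).
  rewrite big_cons eqxx mulrC; congr (_ * _).
  rewrite [RHS]big_seq_cond [LHS]big_seq; apply: eq_bigl => p.
  by case: (boolP (p \in s)) => //= ps; apply/esym; apply: contraNneq as_ => <-.
rewrite [LHS]mulr_sumr; apply: eq_big_seq => p ps.
rewrite big_cons ifT; last by apply: contraNneq as_ => ->.
exact: mulrCA.
Qed.

(** The guard [m != 0] matters for the [j] in [r] of degree above [|n|], where [g] may lack the next
    derivative but the exponent is 0. *)
Lemma is_derive_dpow (f : V -> F) (df : F) m :
  (m != 0%N -> is_derive x v f df) ->
  is_derive x v (fun y => dpow (f y) m) (dpow' (f x) m * df).
Proof.
case: m => [_|m /(_ isT) fdf].
  rewrite mul0r (_ : (fun _ => _) = cst 1); first exact: is_derive_cst.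
  by apply/funext => y; rewrite /dpow expr0 fact0 divr1.
rewrite (_ : (fun _ => _) = m.+1`!%:R^-1 \*: (f ^+ m.+1)); last first.
  by apply/funext => y; rewrite /dpow mulrC exprfctE.
apply: is_derive_eq; rewrite /= /dpow /GRing.scale/= mulrA factS natrM invfM.
by rewrite mulrA [_^-1 * _^-1]mulrC -[_ * m.+1%:R]mulrA mulVf ?pnatr_eq0// mulr1
  [_^-1 * _]mulrC.
Qed.

End derivatives_of_sums_and_products.

Section faa_di_bruno.
Context {F : numFieldType}.
Hypothesis derive_comm : forall d (f : 'rV[F]_d -> F) (x u v : 'rV[F]_d),
  (\forall y \near x, differentiable f y) ->
  differentiable ('D_u f) x -> differentiable ('D_v f) x ->
  'D_v ('D_u f) x = 'D_u ('D_v f) x.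
Context {d1 d2 : nat} (N : nat) (r : seq (mindex_neq0 d1)).
Hypotheses (r_uniq : uniq r)
  (rE : forall j, (j \in r) = (mdeg (val j) <= N)%N).

(** A new outermost derivative breaks the canonical order of [mindex_seq]; symmetry restores it. *)
Lemma partial_mindex d (f : 'rV[F]_d -> F) (n : mindex d) i x :
  times_differentiable (mdeg n).+1 f x ->
  partial i (partials (mindex_seq n) f) x = partials (mindex_seq (n + munit i)) f x.
Proof.
move=> tf; apply/esym; apply: (partials_perm derive_comm (t := i :: mindex_seq n)).
  by apply: perm_mindex_seq; rewrite mcount_cons mcount_mindex_seq.
by rewrite size_mindex_seq mdegD mdeg_munit addn1.
Qed.

Lemma is_derive_partials d (f : 'rV[F]_d -> F) (n : mindex d) i x :
  times_differentiable (mdeg n).+1 f x ->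
  is_derive x (delta_mx 0 i) (partials (mindex_seq n) f)
    (partials (mindex_seq (n + munit i)) f x).
Proof.
move=> tf; apply: DeriveDef; last exact: partial_mindex.
apply: diff_derivable.
have [//] : times_differentiable 1 (partials (mindex_seq n) f) x.
by apply: times_differentiable_partials; rewrite size_mindex_seq addn1.
Qed.

Variables (g : 'rV[F]_d1 -> 'rV[F]_d2) (f : 'rV[F]_d2 -> F).

Let X y (a : mindex d1) l := partials (mindex_seq a) (fun z => g z 0 l) y.

Let C y (j : mindex_neq0 d1) l := X y (val j) l / (mfact (val j))%:R.

Let Phi y (k : mindex d2) := partials (mindex_seq k) f (g y).

Lemma is_derive_outer (k : mindex d2) i x :
  vtimes_differentiable 1 g x -> times_differentiable (mdeg k).+1 f (g x) ->
  is_derive x (delta_mx 0 i) (fun y => Phi y k)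
    (\sum_l X x (munit i) l * Phi x (k + munit l)).
Proof.
move=> tg tf.
have tk : times_differentiable 1 (partials (mindex_seq k) f) (g x).
  by apply: times_differentiable_partials; rewrite size_mindex_seq addn1.
have dg l : differentiable (fun y => g y 0 l) x by case: (tg l).
have dk : differentiable (partials (mindex_seq k) f) (g x) by case: tk.
apply: DeriveDef.
  apply: diff_derivable; apply: differentiable_comp dk.
  exact: differentiable_row.
rewrite [LHS](derive_comp_row _ dg dk); apply: eq_bigr => l _.
rewrite mulrC partial_mindex//; congr (_ * _).
rewrite /X -[munit i]add0r -partial_mindex ?mdeg0//.
apply: near_eq_derive; apply: filterE => y.
suff -> : mindex_seq (0 : mindex d1) = [::] by [].
by apply: size0nil; rewrite size_mindex_seq mdeg0.
Qed.

(** The product rule on each term yields the two sums of [bell_sum_rec]. The factor [(n i).+1] is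
    the one that turns the factorial of [n] into that of [n + munit i]. *)
Lemma is_derive_bell_sum n i x : (mdeg n < N)%N ->
  vtimes_differentiable (mdeg n).+1 g x ->
  times_differentiable (mdeg n).+1 f (g x) ->
  is_derive x (delta_mx 0 i) (fun y => bell_sum r (C y) (Phi y) 0 n)
    ((n i).+1%:R * bell_sum r (C x) (Phi x) 0 (n + munit i)).
Proof.
move=> nN tg tf; have vfin := finite_vpartitions r_uniq (d2:=d2) 0 n.
pose c' (p : mindex_neq0 d1 * 'I_d2) :=
  X x (val p.1 + munit i) p.2 / (mfact (val p.1))%:R.
pose T := finmap.enum_fset (fset_set (vpartitions (d2 := d2) r 0 n)).
have inT kk : kk \in T -> vpartitions r 0 n kk.
  by rewrite in_fset_set// inE.
have -> : (fun y => bell_sum r (C y) (Phi y) 0 n) =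
    (fun y => \sum_(kk <- T) bell_term r (C y) kk * Phi y (vtotal r kk)).
  by apply/funext => y; rewrite /bell_sum fsbig_finite.
have dterm kk : kk \in T ->
  is_derive x (delta_mx 0 i) (fun y => bell_term r (C y) kk)
    (\sum_(p <- vpairs r) c' p * bell_term' r (C x) kk p).
  move=> /inT kkn.
  rewrite [X in is_derive _ _ _ X](_ : _ = \sum_(p <- vpairs r)
      dpow' (C x p.1 p.2) (kk p.1 p.2) * c' p *
      \prod_(q <- vpairs r | q != p) dpow (C x q.1 q.2) (kk q.1 q.2)); last first.
    by apply: eq_bigr => p _; rewrite /bell_term' mulrA [c' p * _]mulrC.
  apply: is_derive_prod_seq => [|[j l] _]; first exact: vpairs_uniq.
  apply: is_derive_dpow => /= kkjl.
  have jn : (mdeg (val j) <= mdeg n)%N.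
    rewrite -[leqLHS]addn0 -(@mdeg0 d1).
    apply: (vpartitions_supp r_uniq kkn); apply: contraNneq kkjl => ->.
    by rewrite ffunE.
  have tgj : times_differentiable (mdeg (val j)).+1 (fun z => g z 0 l) x.
    by apply: times_differentiable_le (tg l).
  have := is_deriveZ (mfact (val j))%:R^-1 (is_derive_partials i tgj).
  rewrite /c' /C /X /=.
  rewrite [X in is_derive _ _ X _](_ : _ = fun y =>
    partials (mindex_seq (\val j)) (fun z => g z 0 l) y / (mfact (val j))%:R).
    by rewrite [X in is_derive _ _ _ X]mulrC.
  by apply/funext => y; rewrite mulrC.
have dPhi kk : kk \in T ->
  is_derive x (delta_mx 0 i) (fun y => Phi y (vtotal r kk))
    (\sum_l X x (munit i) l * Phi x (vtotal r kk + munit l)).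
  move=> /inT/mdeg_vtotal; rewrite mdeg0 addn0 => kkn.
  apply: is_derive_outer.
    by move=> l; apply: times_differentiable_le (tg l).
  exact: times_differentiable_le tf.
rewrite (bell_sum_rec r_uniq rE (X x))//.
apply: is_derive_eq.
  apply: is_derive_sum_seq => kk kkT.
  exact: is_deriveM (dterm _ kkT) (dPhi _ kkT).
(* First the terms where the derivative hits the Bell factor, then those where it hits [Phi]. *)
rewrite big_split/= addrC; congr (_ + _).
  transitivity (\sum_(kk <- T) \sum_(p <- vpairs r)
      c' p * (bell_term' r (C x) kk p * Phi x (vtotal r kk))).
    apply: eq_bigr => kk _; rewrite [LHS]mulrC [LHS]mulr_suml.
    by apply: eq_bigr => p _; rewrite mulrA.
  rewrite exchange_big/=; apply: eq_big_seq => p pP.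
  by rewrite -mulr_sumr -(sum_bell_term' r_uniq)// fsbig_finite.
transitivity (\sum_(kk <- T) \sum_l
    X x (munit i) l * (bell_term r (C x) kk * Phi x (vtotal r kk + munit l))).
  apply: eq_bigr => kk _; rewrite [LHS]mulr_sumr.
  by apply: eq_bigr => l _; rewrite mulrCA.
rewrite exchange_big/=; apply: eq_bigr => l _.
by rewrite -mulr_sumr /bell_sum fsbig_finite.
Qed.

Lemma bell_sum0 c (phi : mindex d2 -> F) : bell_sum r c phi 0 0 = phi 0.
Proof.
have v0 : vpartitions r 0 0 = [set fun=> 0 : mindex d2].
  apply/seteqP; split=> [kk kk0|kk ->].
    apply/funext => j; apply/eqP; apply/negPn/negP => /(vpartitions_supp r_uniq kk0).
    by rewrite !mdeg0 addn0 leqn0 eqn0Ngt mdeg_gt0 (valP j).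
  by split=> //; rewrite /weight big1 ?addr0// => j _; rewrite mdeg0 mulr0n.
rewrite /bell_sum v0 fsbig_set1 /vtotal big1// /bell_term big1 ?mul1r// => p _.
by rewrite ffunE /dpow expr0 fact0 divr1.
Qed.

(** The induction runs over lists of directions, so that each step adds one outermost derivative;
    [mcount] records the multi-index. *)
Lemma partials_comp s x : (size s <= N)%N ->
  vtimes_differentiable (size s) g x -> times_differentiable (size s) f (g x) ->
  partials s (f \o g) x =
  (mfact (mcount s))%:R * bell_sum r (C x) (Phi x) 0 (mcount s).
Proof.
elim: s x => [x _ _ _|i s IHs x /= sN tg tf].
  have -> : mcount [::] = 0 :> mindex d1 by apply/ffunP => i; rewrite !ffunE.
  rewrite mfact0 mul1r bell_sum0 /Phi.
  suff -> : mindex_seq (0 : mindex d2) = [::] by [].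
  by apply: size0nil; rewrite size_mindex_seq mdeg0.
(* To be differentiated, the induction hypothesis must hold near [x], not just at [x]. *)
have near_eq : {near x, partials s (f \o g) =1 fun y =>
    (mfact (mcount s))%:R * bell_sum r (C y) (Phi y) 0 (mcount s)}.
  have gc := vtimes_differentiable_continuous tg.
  have [_ nf _] := tf.
  apply: filterS2 (near_vtimes_differentiable tg) (gc _ nf) => y.
  exact: (IHs y (ltnW sN)).
rewrite /partial (near_eq_derive _ near_eq) mcount_cons mfactD1 mulnC natrM -mulrA.
have dB := @is_derive_bell_sum (mcount s) i x.
rewrite mdeg_mcount in dB; have {}dB := dB sN tg tf.
have := is_deriveZ (mfact (mcount s))%:R dB.
by move=> dZ; rewrite [LHS](@derive_val _ _ _ _ _ _ _ dZ).
Qed.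

End faa_di_bruno.

(** * Bell polynomials as sums of Bell terms, and the final formula *)

Lemma fsbigT_seq (I : choiceType) (V : Type) (idx : V) (op : Monoid.com_law idx)
    (s : seq I) (G : I -> V) :
  uniq s -> (forall j, j \notin s -> G j = idx) ->
  \big[op/idx]_(j \in setT) G j = \big[op/idx]_(j <- s) G j.
Proof.
move=> us G0; rewrite [RHS]fsbig_seq//; apply/esym/fsbig_widen => //.
by move=> j [_ /= /negP]; exact: G0.
Qed.

Section bell_as_bell_sum.
Context {d1 d2 : nat} {F : numFieldType} (N : nat) (r : seq (mindex_neq0 d1)).
Hypotheses (r_uniq : uniq r)
  (rE : forall j, (j \in r) = (mdeg (val j) <= N)%N).

Lemma bell_indexE (n : mindex d1) (k : mindex d2) : (mdeg n <= N)%N ->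
  bell_index n k = vpartitions r 0 n `&` [set kk | vtotal r kk = k].
Proof.
move=> nN; apply/seteqP; split=> kk.
  move=> [kkfin nE kE].
  have kk0 j : j \notin r -> kk j = 0.
    apply: contraNeq => kkj; rewrite rE (leq_trans _ nN)// -nE.
    (* Vanishing outside [r] is still to be proved, so the sum is first taken over the support of
       [kk]. *)
    pose t := finmap.enum_fset (fset_set [set j | kk j != 0]).
    rewrite (@fsbigT_seq _ _ _ _ t) ?finmap.fset_uniq//; last first.
      move=> j'; rewrite in_fset_set// notin_setE /= => /negP/negPn/eqP ->.
      by rewrite mdeg0 mulr0n.
    have jt : j \in t by rewrite in_fset_set// inE.
    rewrite mdeg_sum (bigD1_seq j) ?finmap.fset_uniq//= mdegMn.
    by rewrite (leq_trans _ (leq_addr _ _))// leq_pmulr// mdeg_gt0.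
  split; first split => //.
    by rewrite addr0 -nE (fsbigT_seq _ r_uniq)// => j jr; rewrite kk0// mdeg0 mulr0n.
  by rewrite /= -kE (fsbigT_seq _ r_uniq).
move=> [[kk0 nE] /= kE]; split.
- apply: sub_finite_set (finite_seq r) => j /=.
  by apply: contraNT => /kk0 ->.
- rewrite (fsbigT_seq _ r_uniq); first by rewrite -nE addr0.
  by move=> j /kk0 ->; rewrite mdeg0 mulr0n.
- by rewrite (fsbigT_seq _ r_uniq).
Qed.

Lemma bell_termE (x : mindex_neq0 d1 -> 'rV[F]_d2)
    (kk : mindex_neq0 d1 -> mindex d2) :
  (forall j, j \notin r -> kk j = 0) ->
  \big[*%R/1]_(j \in setT)
    ((mfact (kk j))%:R^-1 * mpow ((mfact (val j))%:R^-1 *: x j) (kk j)) =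
  bell_term r (fun j l => x j 0 l / (mfact (val j))%:R) kk.
Proof.
move=> kk0; rewrite (fsbigT_seq _ r_uniq)//=; last first.
  move=> j /kk0 ->; rewrite mfact0 invr1 mul1r /mpow big1// => l _.
  by rewrite ffunE expr0.
rewrite /bell_term /vpairs big_allpairs; apply: eq_bigr => j _.
rewrite big_enum /= /dpow big_split/= mulrC; congr (_ * _).
  by apply: eq_bigr => l _; rewrite mxE mulrC.
by rewrite prodfV natr_prod.
Qed.

(** Vector partitions of [n] are sorted by their total, whose degree is at most [|n|], so each of
    them is counted for exactly one [k]. *)
Lemma sum_bell (n : mindex d1) (x : mindex_neq0 d1 -> 'rV[F]_d2)
    (phi : mindex d2 -> F) : (mdeg n <= N)%N ->
  \sum_(k \in [set k : mindex d2 | (mdeg k <= mdeg n)%N]) bell n k x * phi k =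
  (mfact n)%:R * bell_sum r (fun j l => x j 0 l / (mfact (val j))%:R) phi 0 n.
Proof.
move=> nN; pose c (j : mindex_neq0 d1) l := x j 0 l / (mfact (val j))%:R.
have vfin := finite_vpartitions (d2 := d2) r_uniq 0 n.
have kfin := @finite_mdeg_le d2 (mdeg n).
have bellE k : bell n k x * phi k = (mfact n)%:R *
    \sum_(kk \in vpartitions r 0 n)
      (* The condition on the total moves into the summand: the range no longer depends on [k], and
         the sums can be exchanged. *)
      if kk \in [set kk | vtotal r kk = k] then bell_term r c kk * phi k else 0.
  rewrite -fsbig_mkcondr /bell -mulrA; congr (_ * _).
  rewrite (bell_indexE k nN) mulr_fsuml; apply: eq_fsbigr => kk.
  by rewrite inE => -[[kk0 _] _]; rewrite bell_termE.
rewrite (eq_fsbigr _ _ (fun k _ => bellE k)) -mulr_fsumr; congr (_ * _).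
rewrite exchange_fsbig//; apply: eq_fsbigr => kk; rewrite inE => kkn.
rewrite (@fsbigD1 _ _ _ _ (vtotal r kk))//=; last first.
  by have := mdeg_vtotal kkn; rewrite mdeg0 addn0.
rewrite ifT ?inE// fsbig1 ?addr0// => k [_ /= kkk].
by rewrite ifF//; apply/negbTE; rewrite notin_setE /= => kE; exact: kkk.
Qed.

End bell_as_bell_sum.

Theorem theorem6p2 (R : realType) (F : numFieldType)
    (hF : F = R :> numFieldType \/ F = R[i] :> numFieldType)
    (d1 d2 d3 : nat) (U : set 'rV[F]_d1) (V : set 'rV[F]_d2)
    (g : 'rV[F]_d1 -> 'rV[F]_d2) (f : 'rV[F]_d2 -> 'rV[F]_d3)
    (gUV : set_fun U V g) (n : mindex d1)
    (hg : forall x, U x -> vtimes_differentiable (mdeg n) g x)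
    (hf : forall y, V y -> vtimes_differentiable (mdeg n) f y)
    (x : 'rV[F]_d1) (Ux : U x) :
  mderivable n (f \o g) x /\
  mderive n (f \o g) x =
    \sum_(k \in [set k : mindex d2 | (mdeg k <= mdeg n)%N])
      bell n k (fun j => mderive (val j) g x) *: mderive k f (g x).
Proof.
have tg := hg x Ux; have tf := hf (g x) (gUV x Ux).
have [iota [iota_norm iota_surj]] := real_embedding hF.
have comm d (h : 'rV[F]_d -> F) (y u v : 'rV[F]_d) :=
  derive_comm iota_norm iota_surj (f := h) (x := y) (u := u) (v := v).
split=> [l|].
  apply: times_differentiable_exist; rewrite size_mindex_seq.
  exact: (times_differentiable_comp tg (tf l)).
apply/rowP => l; rewrite mxE fsbig_finite; last exact: finite_mdeg_le.
rewrite summxE.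
(* The bound [N] is [|n|], the largest degree of a derivative of [g] in the formula. *)
have [r r_uniq rE] := @low_degree_seq d1 (mdeg n).
have := partials_comp comm r_uniq rE (g := g) (f := fun y => f y 0 l)
  (s := mindex_seq n) (x := x).
rewrite size_mindex_seq leqnn mcount_mindex_seq => /(_ isT tg (tf l)) => E.
transitivity (partials (mindex_seq n) ((fun y => f y 0 l) \o g) x); first by [].
rewrite E {E}.
transitivity (\sum_(k \in [set k : mindex d2 | (mdeg k <= mdeg n)%N])
    bell n k (fun j => mderive (val j) g x) *
    partials (mindex_seq k) (fun y => f y 0 l) (g x)); last first.
  rewrite fsbig_finite; last exact: finite_mdeg_le.
  by apply: eq_bigr => k _; rewrite !mxE.
rewrite (sum_bell r_uniq rE)//; congr (_ * bell_sum _ _ _ _ _).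
by apply/funext => j; apply/funext => l'; rewrite mxE.
Qed.
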